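(* Let $n\ge 2$, fix $i_0\in\{1,\dots,n\}$, let $\Omega\subset\mathbb{R}^n$ be open and let $\Phi:\Omega\to\mathcal{C}\ell(n)$ be of class $C^1$, with decomposition $\Phi=\Phi_0+e_{i_0}\Phi_1$ into its even and odd parts $\Phi_0,\Phi_1:\Omega\to\mathcal{C}\ell(n)^+$. Put $\widehat{\Phi}_j=\beta_{i_0}\circ\Phi_j\circ\alpha_{i_0}^{-1}$, $j=0,1$, defined on $\alpha_{i_0}(\Omega)$ with values in $\mathcal{C}\ell(n-1)$. Then $\Phi$ is (left) monogenic in $\Omega$ in the vectorial sense, i.e. $\partial_n\Phi=0$ in $\Omega$, if and only if $\widehat{\Phi}_0$ is (left) antimonogenic and $\widehat{\Phi}_1$ is (left) monogenic in $\alpha_{i_0}(\Omega)$ in the paravectorial sense, i.e. $\overline{\mathcal{D}_{n-1}}\,\widehat{\Phi}_0=0$ and $\mathcal{D}_{n-1}\widehat{\Phi}_1=0$ in $\alpha_{i_0}(\Omega)$. Moreover $\Phi$ is decomposed in the form $$\Phi(\underline{x})=\beta_{i_0}^{-1}\big(\widehat{\Phi}_0(y)\big)+e_{i_0}\,\beta_{i_0}^{-1}\big(\widehat{\Phi}_1(y)\big),\qquad \underline{x}=\alpha_{i_0}^{-1}(y).$$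
   Context: $\mathcal{C}\ell(n)$ is the real unital associative Clifford algebra generated by the standard orthonormal basis $e_1,\dots,e_n$ of $\mathbb{R}^n$ with $e_ie_j+e_je_i=-2\delta_{ij}$; its basis is $e_A=e_{\beta_1}\cdots e_{\beta_k}$ for $A=\{\beta_1<\dots<\beta_k\}\subseteq\{1,\dots,n\}$, $e_\emptyset=1$. $\mathcal{C}\ell(n)^{(k)}$ is the real span of the $e_A$ with $|A|=k$, and $\mathcal{C}\ell(n)^+=\bigoplus_{k\text{ even}}\mathcal{C}\ell(n)^{(k)}$ is the even subalgebra. One has $\mathcal{C}\ell(n)=\mathcal{C}\ell(n)^+\oplus e_{i_0}\mathcal{C}\ell(n)^+$, so each $a\in\mathcal{C}\ell(n)$ is uniquely $a=a_0+e_{i_0}a_1$ with $a_0,a_1\in\mathcal{C}\ell(n)^+$, called its even and odd parts. $\mathbb{R}^n$ is identified with $\mathcal{C}\ell(n)^{(1)}$ via $\underline{x}=\sum_{i=1}^n x^ie_i$, and also $\mathbb{R}^{n}$ is identified with the paravectors $\mathcal{C}\ell(n-1)^{(0)}\oplus\mathcal{C}\ell(n-1)^{(1)}$ via $y=y^0+\sum_{i=1}^{n-1}y^ie_i$. $\beta_{i_0}:\mathcal{C}\ell(n)^+\to\mathcal{C}\ell(n-1)$ is the algebra isomorphism determined by $e_{i_0}e_i\mapsto e_i$ for $i<i_0$ and $e_{i_0}e_i\mapsto e_{i-1}$ for $i>i_0$. $\alpha_{i_0}:\mathcal{C}\ell(n)^{(1)}\to\mathcal{C}\ell(n-1)^{(0)}\oplus\mathcal{C}\ell(n-1)^{(1)}$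 is the vector space isomorphism $\sum_{i=1}^n x^ie_i\mapsto x^{i_0}+\sum_{i=1}^{i_0-1}x^ie_i+\sum_{i=i_0+1}^{n}x^{i}e_{i-1}$. The Dirac operator is $\partial_n=\sum_{j=1}^n e_j\,\partial/\partial x^j$. The Cauchy-Riemann operator acting on $\mathcal{C}\ell(n-1)$-valued functions of $y=(y^0,\dots,y^{n-1})$ is $\mathcal{D}_{n-1}=\partial/\partial y^0+\sum_{j=1}^{n-1}e_j\,\partial/\partial y^j$, and $\overline{\mathcal{D}_{n-1}}=\partial/\partial y^0-\sum_{j=1}^{n-1}e_j\,\partial/\partial y^j$. All operators act from the left. *)

(* Defs.v *)
From HB Require Import structures.
From mathcomp Require Import all_boot all_order all_algebra.
From mathcomp Require Import all_classical all_reals all_analysis.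
From mathcomp Require Import ring.

Set Implicit Arguments.
Unset Strict Implicit.
Unset Printing Implicit Defensive.

Import Order.TTheory GRing.Theory Num.Theory.
Import numFieldNormedType.Exports.

Local Open Scope classical_set_scope.
Local Open Scope ring_scope.

Lemma sorted_enum_ord n :
  sorted (fun j k : 'I_n => (j < k)%N) (enum 'I_n).
Proof.
have := iota_ltn_sorted 0 n; rewrite -val_enum_ord sorted_map; exact.
Qed.

Lemma prod_enum_sorted (X : nzRingType) n (A : {set 'I_n}) (g : 'I_n -> X) :
  exists l : seq 'I_n, [/\ sorted (fun j k : 'I_n => (j < k)%N) l,
    A = [set:: l]%SET & \prod_(i in A) g i = \prod_(i <- l) g i].
Proof.
exists [seq i <- index_enum 'I_n | i \in A]; split; last by rewrite big_filter.
  apply: sorted_filter; first by move=> j k p; exact: ltn_trans.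
  by have := sorted_enum_ord n; rewrite enumT [index_enum _]unlock.
by apply/setP => i; rewrite inE mem_filter mem_index_enum andbT.
Qed.

Section SymmetricDifference.
Context {n : nat}.
Implicit Types A B C : {set 'I_n}.

Definition symd A B : {set 'I_n} := (A :\: B) :|: (B :\: A).

Lemma in_symd A B i : (i \in symd A B) = (i \in A) (+) (i \in B).
Proof. by rewrite !inE; case: (i \in A); case: (i \in B). Qed.

Lemma symdA A B C : symd A (symd B C) = symd (symd A B) C.
Proof. by apply/setP => i; rewrite !in_symd addbA. Qed.

Lemma symdC A B : symd A B = symd B A.
Proof. by apply/setP => i; rewrite !in_symd addbC. Qed.

Lemma symd0 A : symd A finset.set0 = A.
Proof. by apply/setP => i; rewrite !in_symd inE addbF. Qed.

Lemma sym0d A : symd finset.set0 A = A.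
Proof. by rewrite symdC symd0. Qed.

Lemma symdK A B : symd A (symd A B) = B.
Proof. by apply/setP => i; rewrite !in_symd addbA addbb. Qed.

Lemma symd_inj A : injective (symd A).
Proof. exact: can_inj (symdK A). Qed.

Lemma odd_sum_symd A B (F : 'I_n -> nat) :
  odd (\sum_(i in symd A B) F i) =
  odd (\sum_(i in A) F i) (+) odd (\sum_(i in B) F i).
Proof.
have oddE (D : {set 'I_n}) :
    odd (\sum_(i in D) F i) = \big[addb/false]_i ((i \in D) && odd (F i)).
  rewrite big_mkcond /= (big_morph odd oddD (erefl : odd 0 = false)).
  by apply: eq_bigr => i _; case: (i \in D).
rewrite !oddE -big_split /=; apply: eq_bigr => i _.
by rewrite in_symd; case: (i \in A); case: (i \in B); case: (odd _).
Qed.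

Lemma odd_card_symd A B : odd #|symd A B| = odd #|A| (+) odd #|B|.
Proof. by rewrite -!sum1_card odd_sum_symd. Qed.

(* Parity of the number of sign changes needed to bring
   [e_A * e_B] to the form [e_(symd A B)]: one for each transposition of
   [e_i], [i \in A], with [e_j], [j \in B], [j < i], and one for each square
   [e_i * e_i = -1], [i \in A :&: B]. *)
Definition clsign A B : bool :=
  odd (\sum_(i in A) \sum_(j in B) (j <= i)%N).

Lemma clsign_symdl A B C : clsign (symd A B) C = clsign A C (+) clsign B C.
Proof. exact: odd_sum_symd. Qed.

Lemma clsign_symdr A B C : clsign A (symd B C) = clsign A B (+) clsign A C.
Proof.
rewrite /clsign !(big_morph odd oddD (erefl : odd 0 = false)) -big_split /=.
by apply: eq_bigr => i _; rewrite odd_sum_symd.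
Qed.

Lemma clsign0s A : clsign finset.set0 A = false.
Proof. by rewrite /clsign big_set0. Qed.

Lemma clsigns0 A : clsign A finset.set0 = false.
Proof. by rewrite /clsign big1 // => i _; rewrite big_set0. Qed.

Lemma clsign1s i B : clsign [set i]%SET B = odd (\sum_(j in B) (j <= i)%N).
Proof. by rewrite /clsign big_set1. Qed.

End SymmetricDifference.

(* The Clifford algebra [Cl R n] is the free module on the subsets of
   [{0, ..., n-1}]; the generator written e_(i+1) in 1-based notation is
   [cle i], [i : 'I_n].  The coefficients are stored in a row vector indexed by
   the enumeration of [{set 'I_n}], from which [Cl R n] inherits its
   finite-dimensional normed topology. *)
Definition Cl (R : realType) (n : nat) : Type := 'rV[R]_#|{set 'I_n}|.

HB.instance Definition _ (R : realType) (n : nat) :=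
  NormedModule.copy (Cl R n) 'rV[R]_#|{set 'I_n}|.

Section CliffordAlgebra.
Context {R : realType} {n : nat}.
Implicit Types (a b c : Cl R n) (A B C : {set 'I_n}) (i j : 'I_n).

Definition clcoef a A : R := (a : 'rV[R]_#|{set 'I_n}|) ord0 (enum_rank A).

Definition clbasis A : Cl R n := (delta_mx ord0 (enum_rank A) : 'rV[R]_#|{set 'I_n}|).

Definition clmul a b : Cl R n :=
  \sum_A \sum_B ((-1) ^+ clsign A B * (clcoef a A * clcoef b B)) *:
    clbasis (symd A B).

Lemma clP a b : (forall A, clcoef a A = clcoef b A) -> a = b.
Proof.
move=> ab; apply/rowP => k; have := ab (enum_val k).
by rewrite /clcoef enum_valK.
Qed.

Lemma clcoef_is_linear A : linear (fun a => clcoef a A : R^o).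
Proof. by move=> k a b; rewrite /clcoef !mxE. Qed.

Lemma clcoefD a b A : clcoef (a + b) A = clcoef a A + clcoef b A.
Proof. by rewrite /clcoef mxE. Qed.

Lemma clcoefN a A : clcoef (- a) A = - clcoef a A.
Proof. by rewrite /clcoef mxE. Qed.

Lemma clcoefZ k a A : clcoef (k *: a) A = k * clcoef a A.
Proof. by rewrite /clcoef mxE. Qed.

Lemma clcoef0 A : clcoef 0 A = 0.
Proof. by rewrite /clcoef mxE. Qed.

Lemma clcoef_sum I (r : seq I) (P : pred I) (F : I -> Cl R n) A :
  clcoef (\sum_(i <- r | P i) F i) A = \sum_(i <- r | P i) clcoef (F i) A.
Proof. exact: (big_morph _ (fun a b => clcoefD a b A) (clcoef0 A)). Qed.

Lemma clcoef_basis A B : clcoef (clbasis A) B = (A == B)%:R.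
Proof.
by rewrite /clcoef /clbasis mxE eqxx /= (inj_eq enum_rank_inj) eq_sym.
Qed.

Lemma cl_sum_basis a : a = \sum_A clcoef a A *: clbasis A.
Proof.
apply: clP => B; rewrite clcoef_sum (bigD1 B) //= clcoefZ clcoef_basis eqxx.
rewrite mulr1 big1 ?addr0 // => A AB.
by rewrite clcoefZ clcoef_basis (negPf AB) mulr0.
Qed.

Lemma clcoef_mul a b C : clcoef (clmul a b) C =
  \sum_A (-1) ^+ clsign A (symd A C) * (clcoef a A * clcoef b (symd A C)).
Proof.
rewrite clcoef_sum; apply: eq_bigr => A _.
rewrite clcoef_sum (bigD1 (symd A C)) //= clcoefZ clcoef_basis symdK eqxx mulr1.
rewrite big1 ?addr0 // => B BA; rewrite clcoefZ clcoef_basis.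
case: eqP => [E|_]; last by rewrite mulr0.
by rewrite -E symdK eqxx in BA.
Qed.

Lemma clmulDl : left_distributive clmul +%R.
Proof.
move=> a b c; apply: clP => C; rewrite clcoefD !clcoef_mul -big_split /=.
by apply: eq_bigr => A _; rewrite clcoefD mulrDl mulrDr.
Qed.

Lemma clmulDr : right_distributive clmul +%R.
Proof.
move=> a b c; apply: clP => C; rewrite clcoefD !clcoef_mul -big_split /=.
by apply: eq_bigr => A _; rewrite clcoefD !mulrDr.
Qed.

Lemma clmulA : associative clmul.
Proof.
move=> a b c; apply: clP => D; rewrite !clcoef_mul.
under eq_bigr do rewrite clcoef_mul mulr_sumr mulr_sumr.
under [RHS]eq_bigr do rewrite clcoef_mul mulr_suml mulr_sumr.
rewrite [RHS]exchange_big /=; apply: eq_bigr => A _.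
rewrite [RHS](reindex_inj (@symd_inj _ A)) /=; apply: eq_bigr => B _.
rewrite symdK -(symdA A B D) !clsign_symdl !clsign_symdr !signr_addb.
set x := clcoef a A; set y := clcoef b B.
rewrite (_ : symd B (symd A D) = symd A (symd B D)); last first.
  by rewrite symdA (symdC B A) -symdA.
set z := clcoef c _.
have sq (s : bool) : (-1) ^+ s * (-1) ^+ s = 1 :> R.
  by rewrite -signr_addb addbb.
move: (sq (clsign A B));
move: ((-1 : R) ^+ clsign A A) ((-1 : R) ^+ clsign A B) ((-1 : R) ^+ clsign A D)
  ((-1 : R) ^+ clsign B A) ((-1 : R) ^+ clsign B B) ((-1 : R) ^+ clsign B D) x y z.
by move=> p1 p2 p3 p4 p5 p6 p7 p8 p9 pp; rewrite -[LHS]mul1r -pp; ring.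
Qed.

Lemma clmul1l : left_id (clbasis finset.set0) clmul.
Proof.
move=> a; apply: clP => C; rewrite clcoef_mul (bigD1 finset.set0) //=.
rewrite clsign0s expr0 mul1r clcoef_basis eqxx mul1r sym0d big1 ?addr0 // => A A0.
by rewrite clcoef_basis eq_sym (negPf A0) mul0r mulr0.
Qed.

Lemma clmul1r : right_id (clbasis finset.set0) clmul.
Proof.
move=> a; apply: clP => C; rewrite clcoef_mul (bigD1 C) //=.
have -> : symd C C = finset.set0 by rewrite -{2}(symd0 C) symdK.
rewrite clsigns0 expr0 mul1r clcoef_basis eqxx mulr1 big1 ?addr0 // => A AC.
rewrite clcoef_basis; case: eqP => [E|_]; last by rewrite !mulr0.
by move: AC; rewrite -(symdK A C) -E symd0 eqxx.
Qed.

Lemma clone_neq0 : clbasis finset.set0 != 0.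
Proof.
apply/eqP => /(congr1 (clcoef ^~ finset.set0)).
by rewrite clcoef_basis eqxx clcoef0 => /eqP; rewrite oner_eq0.
Qed.

HB.instance Definition _ := GRing.Zmodule_isNzRing.Build (Cl R n)
  clmulA clmul1l clmul1r clmulDl clmulDr clone_neq0.

Lemma clscaleAl k a b : k *: (a * b) = k *: a * b.
Proof.
apply: clP => C; rewrite clcoefZ !clcoef_mul mulr_sumr; apply: eq_bigr => A _.
by rewrite clcoefZ mulrCA; congr (_ * _); rewrite mulrA.
Qed.

HB.instance Definition _ :=
  GRing.Lmodule_isLalgebra.Build R (Cl R n) clscaleAl.

Lemma clscaleAr k a b : k *: (a * b) = a * (k *: b).
Proof.
apply: clP => C; rewrite clcoefZ !clcoef_mul mulr_sumr; apply: eq_bigr => A _.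
by rewrite clcoefZ mulrCA; congr (_ * _); rewrite mulrCA.
Qed.

HB.instance Definition _ :=
  GRing.Lalgebra_isAlgebra.Build R (Cl R n) clscaleAr.

Definition cle (i : 'I_n) : Cl R n := clbasis [set i]%SET.

Lemma clbasisM A B :
  clbasis A * clbasis B = (-1) ^+ clsign A B *: (clbasis (symd A B) : Cl R n).
Proof.
apply: clP => C; rewrite clcoef_mul clcoefZ (bigD1 A) //=.
rewrite !clcoef_basis eqxx mul1r big1 ?addr0 => [|D DA].
  rewrite (can2_eq (symdK A) (symdK A)).
  by case: eqP => [->|]; rewrite ?mulr0 // mulr0.
by rewrite clcoef_basis eq_sym (negPf DA) mul0r mulr0.
Qed.

Lemma clsign11 i j : clsign [set i]%SET [set j]%SET = (j <= i)%N.
Proof. by rewrite /clsign !big_set1 oddb. Qed.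

Lemma cle_sq i : cle i * cle i = -1.
Proof.
rewrite clbasisM clsign11 leqnn expr1 scaleN1r.
by have -> : symd [set i]%SET [set i]%SET = finset.set0
  by rewrite -{2}(symd0 [set i]%SET) symdK.
Qed.

Lemma cle_anti i j : i != j -> cle i * cle j = - (cle j * cle i).
Proof.
move=> ij; rewrite !clbasisM !clsign11 (symdC [set j]%SET) -scaleNr.
congr (_ *: _); move: ij; rewrite -(inj_eq val_inj) /=.
by case: ltngtP => // _ _; rewrite expr0 expr1 ?opprK.
Qed.

Lemma cle_rel i j : cle i * cle j + cle j * cle i = - (2 * (i == j)%:R).
Proof.
have [<-|ij] := eqVneq i j; last by rewrite cle_anti // mulr0 oppr0 addNr.
by rewrite cle_sq mulr1 -opprD.
Qed.

Section UniversalProperty.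
Context {X : algType R} (g : 'I_n -> X).

Definition clifford_relations : Prop :=
  (forall i, g i * g i = -1) /\ (forall i j, i != j -> g i * g j = - (g j * g i)).

Hypothesis g_rel : clifford_relations.

Lemma clgen_mul_seq (i : 'I_n) (l : seq 'I_n) B :
  sorted (fun j k : 'I_n => (j < k)%N) l -> i \in l ->
  g i * \prod_(j <- l | j \in B) g j =
  (-1) ^+ odd (\sum_(j <- l | j \in B) (j <= i)%N) *:
    \prod_(j <- l | j \in symd [set i]%SET B) g j.
Proof.
have lt_tr : transitive (fun j k : 'I_n => (j < k)%N).
  by move=> j k p; exact: ltn_trans.
elim: l => // k l IH kl; rewrite inE => ikl.
have klt (j : 'I_n) : j \in l -> (k < j)%N.
  by move=> jl; have /allP := order_path_min lt_tr kl; exact.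
rewrite !big_cons in_symd !inE eq_sym.
have [ki|ki] := eqVneq i k.
  rewrite ki addTb.
  have E0 : (\sum_(j <- l | j \in B) (j <= k)%N = 0)%N.
    by rewrite big_seq_cond big1 // => j /andP[/klt + _]; rewrite ltnNge => /negPf->.
  have E1 : \prod_(j <- l | j \in symd [set k]%SET B) g j =
            \prod_(j <- l | j \in B) g j.
    rewrite big_seq_cond [RHS]big_seq_cond; apply: eq_bigl => j.
    have [/klt|//] := boolP (j \in l); rewrite in_symd inE.
    by rewrite -(inj_eq val_inj) /=; case: ltngtP.
  rewrite E0 E1; case: (k \in B) => /=; last by rewrite expr0 scale1r.
  by rewrite leqnn addn0 expr1 mulrA (g_rel.1 k) mulN1r scaleN1r.
have il : i \in l by move: ikl; rewrite (negPf ki).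
have {}IH := IH (path_sorted kl) il.
rewrite addFb; case: (k \in B); last exact: IH.
rewrite (ltnW (klt _ il)) mulrA g_rel.2 // mulNr -mulrA IH.
by rewrite add1n /= signrN scaleNr -scalerAr.
Qed.

Lemma clgen_mul (i : 'I_n) B :
  g i * \prod_(j in B) g j =
  (-1) ^+ clsign [set i]%SET B *: \prod_(j in symd [set i]%SET B) g j.
Proof.
rewrite clsign1s; apply: clgen_mul_seq; last by rewrite mem_index_enum.
by have := sorted_enum_ord n; rewrite enumT [index_enum _]unlock.
Qed.

Lemma clgen_prod_mul A B :
  \prod_(i in A) g i * \prod_(j in B) g j =
  (-1) ^+ clsign A B *: \prod_(j in symd A B) g j.
Proof.
have lt_tr : transitive (fun j k : 'I_n => (j < k)%N).
  by move=> j k p; exact: ltn_trans.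
have [l [lS lA ->]] := prod_enum_sorted A (g : 'I_n -> X).
rewrite {A}lA; elim: l lS => [_|k l IH kl].
  by rewrite big_nil mul1r finset.set_nil sym0d clsign0s expr0 scale1r.
have klt (j : 'I_n) : j \in l -> (k < j)%N.
  by move=> jl; have /allP := order_path_min lt_tr kl; exact.
have -> : [set:: k :: l]%SET = symd [set k]%SET [set:: l]%SET.
  apply/setP => j; rewrite in_symd !inE.
  case: eqP => [->|//]; case: (boolP (k \in l)) => // /klt.
  by rewrite ltnn.
rewrite big_cons -mulrA IH ?(path_sorted kl) // -scalerAr clgen_mul scalerA.
rewrite symdA -signr_addb clsign_symdl clsign_symdr.
suff -> : clsign [set k]%SET [set:: l]%SET = false by rewrite addFb addbC.
rewrite clsign1s big1 // => j; rewrite inE => /klt.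
by rewrite ltnNge => /negPf ->.
Qed.

(* The algebra morphism from [Cl R n] that sends [cle i] to [g i]. *)
Definition cllift of clifford_relations := fun a : Cl R n =>
  \sum_A clcoef a A *: \prod_(i in A) g i.

Local Notation lift := (cllift g_rel).

Lemma cllift_is_linear : linear lift.
Proof.
move=> k a b; rewrite /cllift scaler_sumr -big_split /=; apply: eq_bigr => A _.
by rewrite clcoefD clcoefZ scalerDl scalerA.
Qed.

HB.instance Definition _ := GRing.isLinear.Build R (Cl R n) X *:%R lift
  cllift_is_linear.

Lemma cllift_basis A : lift (clbasis A) = \prod_(i in A) g i.
Proof.
rewrite /cllift (bigD1 A) //= clcoef_basis eqxx scale1r [X in _ + X]big1 ?addr0 // => B BA.
by rewrite clcoef_basis eq_sym (negPf BA) scale0r.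
Qed.

Lemma cllift_is_monoid_morphism : monoid_morphism lift.
Proof.
split; first by rewrite cllift_basis big_set0.
move=> a b; rewrite {1}(cl_sum_basis a) {1}(cl_sum_basis b) mulr_suml linear_sum.
have liftE (x : Cl R n) : lift x = \sum_A clcoef x A *: \prod_(i in A) g i by [].
rewrite (liftE a) mulr_suml; apply: eq_bigr => A _.
rewrite (liftE b) !mulr_sumr linear_sum; apply: eq_bigr => B _.
rewrite -!(scalerAl, scalerAr) clbasisM !linearZ /= cllift_basis.
by rewrite -clgen_prod_mul !scalerA mulrC.
Qed.

HB.instance Definition _ := GRing.isMonoidMorphism.Build (Cl R n) X lift
  cllift_is_monoid_morphism.

Lemma cllift_cle i : lift (cle i) = g i.
Proof. by rewrite cllift_basis big_set1. Qed.

End UniversalProperty.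

Lemma cle_clifford : clifford_relations (cle : 'I_n -> Cl R n).
Proof. by split; [exact: cle_sq|exact: cle_anti]. Qed.

Lemma clbasis_prod A : clbasis A = \prod_(i in A) cle i.
Proof.
have lt_tr : transitive (fun j k : 'I_n => (j < k)%N).
  by move=> j k p; exact: ltn_trans.
have [l [lS lA ->]] := prod_enum_sorted A (cle : 'I_n -> Cl R n).
rewrite {A}lA; elim: l lS => [_|k l IH kl]; first by rewrite big_nil finset.set_nil.
have klt (j : 'I_n) : j \in l -> (k < j)%N.
  by move=> jl; have /allP := order_path_min lt_tr kl; exact.
rewrite big_cons -IH ?(path_sorted kl) // clbasisM.
have -> : clsign [set k]%SET [set:: l]%SET = false.
  rewrite clsign1s big1 // => j; rewrite inE => /klt.
  by rewrite ltnNge => /negPf ->.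
rewrite expr0 scale1r; congr clbasis.
apply/setP => j; rewrite in_symd !inE.
case: eqP => [->|//]; case: (boolP (k \in l)) => // /klt.
by rewrite ltnn.
Qed.

Definition cleven : {pred Cl R n} :=
  fun a => [forall A : {set 'I_n}, odd #|A| ==> (clcoef a A == 0)].

Lemma clevenP a :
  reflect (forall A, odd #|A| -> clcoef a A = 0) (a \in cleven).
Proof.
apply: (iffP forallP) => [aE A oA|aE A]; last by apply/implyP => /aE ->.
by have /implyP/(_ oA)/eqP := aE A.
Qed.

Lemma clbasis_even A : (clbasis A \in cleven) = ~~ odd #|A|.
Proof.
apply/clevenP/idP => [|oA B oB].
  by apply: contraPN => oA /(_ A oA)/eqP; rewrite clcoef_basis eqxx oner_eq0.
by rewrite clcoef_basis; case: eqP => // AB; rewrite AB oB in oA.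
Qed.

Lemma cleven_subalg : subalg_closed cleven.
Proof.
split=> [|k a b /clevenP aE /clevenP bE|a b /clevenP aE /clevenP bE].
- by rewrite [_ \in _]clbasis_even cards0.
- by apply/clevenP => A oA; rewrite clcoefD clcoefZ aE // bE // mulr0 addr0.
- apply/clevenP => C oC; rewrite clcoef_mul big1 // => A _.
  have [oA|oA] := boolP (odd #|A|); first by rewrite aE // mul0r mulr0.
  by rewrite bE ?mulr0 // odd_card_symd (negPf oA).
Qed.

HB.instance Definition _ :=
  GRing.isSubalgClosed.Build R (Cl R n) cleven cleven_subalg.

End CliffordAlgebra.

Record Cleven (R : realType) (n : nat) :=
  ClEven {cleven_val : Cl R n; _ : cleven_val \in cleven}.

HB.instance Definition _ (R : realType) (n : nat) :=
  [isSub for @cleven_val R n].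
HB.instance Definition _ (R : realType) (n : nat) :=
  [Choice of Cleven R n by <:].
HB.instance Definition _ (R : realType) (n : nat) :=
  [SubChoice_isSubAlgebra of Cleven R n by <:].

Section Parts.
Context {R : realType} {n : nat}.
Implicit Types (a : Cl R n) (u v : Cleven R n) (A : {set 'I_n}).

Lemma even_part_subproof a :
  \sum_(A : {set 'I_n} | ~~ odd #|A|) clcoef a A *: clbasis A \in cleven.
Proof.
by apply: rpred_sum => A oA; apply: rpredZ; rewrite clbasis_even.
Qed.

(* [even_part a] and [odd_part i0 a] are the components of [a] in
   [Cl R n = cleven + cle i0 * cleven]. *)
Definition even_part a : Cleven R n := ClEven (even_part_subproof a).

Lemma odd_part_subproof (i0 : 'I_n) a : - cle i0 * (a - cleven_val (even_part a)) \in cleven.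
Proof.
have -> : a - cleven_val (even_part a) =
    \sum_(A : {set 'I_n} | odd #|A|) clcoef a A *: clbasis A.
  rewrite {1}(cl_sum_basis a) (bigID (fun A : {set 'I_n} => odd #|A|)) /=.
  by rewrite addrK.
rewrite mulr_sumr; apply: rpred_sum => A oA.
rewrite -scalerAr mulNr rpredZ // rpredN clbasisM rpredZ // clbasis_even.
by rewrite odd_card_symd cards1 oA.
Qed.

Definition odd_part (i0 : 'I_n) a : Cleven R n := ClEven (odd_part_subproof i0 a).

Lemma even_odd_decomposition i0 a :
  a = cleven_val (even_part a) + cle i0 * cleven_val (odd_part i0 a).
Proof. by rewrite /= mulrA mulrN cle_sq opprK mul1r addrC subrK. Qed.

Lemma clcoef_even_part a A :
  clcoef (cleven_val (even_part a)) A = if odd #|A| then 0 else clcoef a A.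
Proof.
rewrite /= clcoef_sum; case: ifP => oA.
  rewrite big1 // => B oB; rewrite clcoefZ clcoef_basis.
  by case: eqP => [E|]; [rewrite E oA in oB|rewrite mulr0].
rewrite (bigD1 A) ?oA //= clcoefZ clcoef_basis eqxx mulr1 big1 ?addr0 // => B.
by case/andP => _ BA; rewrite clcoefZ clcoef_basis (negPf BA) mulr0.
Qed.

Lemma even_odd_unique i0 a u v :
  a = cleven_val u + cle i0 * cleven_val v -> u = even_part a /\ v = odd_part i0 a.
Proof.
move=> auv.
have E : u = even_part a.
  apply: val_inj; apply: clP => A; rewrite clcoef_even_part.
  case: ifPn => oA; first by have /clevenP := valP u; exact.
  rewrite auv clcoefD clcoef_mul big1 ?addr0 // => B _.
  rewrite clcoef_basis; case: eqP => [<-|]; last by rewrite mul0r mulr0.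
  have /clevenP -> := valP v; first by rewrite !mulr0.
  by rewrite odd_card_symd cards1 (negPf oA).
split=> //; apply: val_inj.
change (cleven_val v = - cle i0 * (a - cleven_val (even_part a))).
rewrite -E {1}auv.
by rewrite addrAC subrr add0r mulrA mulNr cle_sq opprK mul1r.
Qed.

End Parts.

Section Beta.
Context {R : realType} {m : nat} (i0 : 'I_m.+1).
Implicit Types (B : {set 'I_m}) (A : {set 'I_m.+1}).

Lemma cleMcle_even (i j : 'I_m.+1) : (cle i * cle j : Cl R m.+1) \in cleven.
Proof. by rewrite clbasisM rpredZ // clbasis_even odd_card_symd !cards1. Qed.

Definition cle2 (i j : 'I_m.+1) : Cleven R m.+1 := ClEven (cleMcle_even i j).

Definition beta_gen (j : 'I_m) : Cleven R m.+1 := cle2 i0 (lift i0 j).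

Lemma beta_gen_clifford : clifford_relations beta_gen.
Proof.
have i0l j : i0 != lift i0 j by exact: neq_lift.
have E j k : cleven_val (beta_gen j * beta_gen k) =
    cle (lift i0 j) * cle (lift i0 k).
  rewrite [LHS]/= [cle i0 * cle (lift i0 j)]cle_anti // mulNr.
  rewrite -mulrA [cle i0 * (_ * _)]mulrA cle_sq mulN1r mulrN opprK //.
split=> [j|j k jk]; apply: val_inj.
  by apply: (etrans (E j j)); rewrite cle_sq.
apply: (etrans (E j k)); rewrite cle_anti ?(inj_eq lift_inj) //.
by rewrite -(E k j).
Qed.

(* The algebra morphism with [cle j |-> cle i0 * cle (lift i0 j)]; [lift i0]
   enumerates the indices different from [i0] in increasing order. *)
Definition beta_inv : Cl R m -> Cleven R m.+1 := cllift beta_gen_clifford.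

HB.instance Definition _ :=
  GRing.LRMorphism.copy beta_inv (cllift beta_gen_clifford).

Definition beta_supp B : {set 'I_m.+1} :=
  [set k | if unlift i0 k is Some j then j \in B else odd #|B|]%SET.

Lemma beta_invE b :
  beta_inv b = \sum_B clcoef b B *: \prod_(j in B) beta_gen j.
Proof. by []. Qed.

Lemma beta_inv_cle j : beta_inv (cle j) = cle2 i0 (lift i0 j).
Proof. exact: cllift_cle. Qed.

Lemma beta_gen_prod B : exists s : bool,
  cleven_val (\prod_(j in B) beta_gen j) = (-1) ^+ s *: clbasis (beta_supp B).
Proof.
have [l [lS -> ->]] := prod_enum_sorted B beta_gen.
elim: l lS => [_|k l IH kl].
  exists false; rewrite big_nil expr0 scale1r.
  suff -> : beta_supp [set:: [::]]%SET = finset.set0 by [].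
  apply/setP => k; rewrite !inE finset.set_nil cards0.
  by case: (unlift i0 k) => // j; rewrite inE.
have lt_tr : transitive (fun j k : 'I_m => (j < k)%N).
  by move=> j k' p; exact: ltn_trans.
have klt (j : 'I_m) : j \in l -> (k < j)%N.
  by move=> jl; have /allP := order_path_min lt_tr kl; exact.
have [s IHs] := IH (path_sorted kl).
pose t := symd [set i0]%SET [set lift i0 k]%SET.
exists (clsign [set i0]%SET [set lift i0 k]%SET (+) s (+)
        clsign t (beta_supp [set:: l]%SET)).
rewrite big_cons.
transitivity (cle i0 * cle (lift i0 k) *
  cleven_val (\prod_(j <- l) beta_gen j)); first by [].
rewrite IHs clbasisM -scalerAl -scalerAr clbasisM !scalerA -!signr_addb.
congr (_ *: clbasis _); apply/setP => p; rewrite !(in_symd, inE).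
have -> : [set:: k :: l]%SET = symd [set k]%SET [set:: l]%SET.
  apply/setP => j; rewrite in_symd !inE.
  case: eqP => [->|//]; case: (boolP (k \in l)) => // /klt.
  by rewrite ltnn.
case: unliftP => [j ->|->].
  rewrite in_symd !inE (inj_eq lift_inj) eq_sym.
  by rewrite (negPf (neq_lift _ _)).
by rewrite eqxx (negPf (neq_lift _ _)) odd_card_symd cards1.
Qed.

(* [beta_inv (clbasis B)] is [clbasis (beta_supp B)] up to a sign, which is read
   off as its coefficient on [beta_supp B]; [beta] is the inverse of
   [beta_inv]. *)
Definition beta (a : Cleven R m.+1) : Cl R m :=
  \sum_B (clcoef (cleven_val (beta_inv (clbasis B))) (beta_supp B) *
          clcoef (cleven_val a) (beta_supp B)) *: clbasis B.

Lemma beta_supp_inj : injective beta_supp.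
Proof.
move=> B C /setP BC; apply/setP => j.
by have := BC (lift i0 j); rewrite !inE liftK.
Qed.

Lemma beta_supp_even A : ~~ odd #|A| -> exists B, A = beta_supp B.
Proof.
move=> oA; pose B : {set 'I_m} := [set j | lift i0 j \in A]%SET.
exists B; apply/setP => k; rewrite !inE; case: unliftP => [j ->|->].
  by rewrite inE.
have cA : #|A| = ((i0 \in A) + #|B|)%N.
  rewrite (cardD1 i0); congr (_ + _)%N.
  rewrite -(card_imset _ (@lift_inj _ i0)); apply: eq_card => p; rewrite !inE.
  case: (unliftP i0 p) => [j ->|->].
    by rewrite (mem_imset _ _ (@lift_inj _ i0)) inE eq_sym neq_lift.
  rewrite eqxx /=; apply/esym/negbTE/imsetP => -[j _ /eqP].
  by rewrite (negPf (neq_lift _ _)).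
move: oA; rewrite cA oddD oddb negb_add; by move/eqP.
Qed.

Lemma beta_inv_basis B : exists s : bool,
  cleven_val (beta_inv (clbasis B)) = (-1) ^+ s *: clbasis (beta_supp B).
Proof. by rewrite [beta_inv _]cllift_basis; exact: beta_gen_prod. Qed.

Lemma cleven_val_sum I (r : seq I) (P : pred I) (F : I -> Cleven R m.+1) :
  cleven_val (\sum_(i <- r | P i) F i) = \sum_(i <- r | P i) cleven_val (F i).
Proof. exact: (big_morph (@cleven_val R m.+1)). Qed.

Lemma beta_linear : linear beta.
Proof.
move=> k a b; rewrite /beta scaler_sumr -big_split /=; apply: eq_bigr => B _.
rewrite clcoefD clcoefZ mulrDr scalerDl scalerA; congr (_ *: _ + _).
by rewrite mulrCA.
Qed.

HB.instance Definition _ :=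
  GRing.isLinear.Build R (Cleven R m.+1) (Cl R m) *:%R beta beta_linear.

Lemma beta_invK : cancel beta_inv beta.
Proof.
have basisK B : beta (beta_inv (clbasis B)) = clbasis B.
  rewrite {1}/beta (bigD1 B) // big1 => [|C /andP[_ CB]].
    have [s ->] := beta_inv_basis B; rewrite clcoefZ clcoef_basis eqxx mulr1.
    by rewrite -signr_addb addbb expr0 scale1r; exact: addr0.
  have [s ->] := beta_inv_basis B; rewrite clcoefZ clcoef_basis.
  by rewrite (inj_eq beta_supp_inj) eq_sym (negPf CB) !mulr0 scale0r.
move=> b; rewrite beta_invE linear_sum [RHS](cl_sum_basis b).
apply: eq_bigr => B _; rewrite linearZ -[in RHS]basisK; congr (_ *: beta _).
exact/esym/cllift_basis.
Qed.

Lemma beta_inj : injective beta.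
Proof.
apply: raddf_inj => a /(congr1 (fun b => clcoef b)) a0.
apply: val_inj; apply: clP => A; rewrite [RHS]clcoef0.
have [oA|/beta_supp_even[B ->]] := boolP (odd #|A|).
  by have /clevenP := valP a; exact.
have := congr1 (fun f => f B) a0; rewrite clcoef0 clcoef_sum (bigD1 B) //=.
rewrite clcoefZ clcoef_basis eqxx mulr1 [X in _ + X]big1 => [|C CB].
  have [s ->] := beta_inv_basis B.
  rewrite clcoefZ clcoef_basis eqxx mulr1 addr0 => /eqP.
  by rewrite mulf_eq0 signr_eq0 => /eqP.
by rewrite clcoefZ clcoef_basis (negPf CB) mulr0.
Qed.

Lemma betaK : cancel beta beta_inv.
Proof. by move=> a; apply: beta_inj; rewrite beta_invK. Qed.

Lemma beta_is_monoid_morphism : monoid_morphism beta.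
Proof.
split=> [|a b]; apply: (can_inj beta_invK); rewrite betaK ?rmorph1 //.
by rewrite rmorphM /= !betaK.
Qed.

HB.instance Definition _ := GRing.isMonoidMorphism.Build
  (Cleven R m.+1) (Cl R m) beta beta_is_monoid_morphism.

Lemma beta_cle2 j : beta (cle2 i0 (lift i0 j)) = cle j.
Proof. by rewrite -beta_inv_cle beta_invK. Qed.

Lemma beta_unique (f : {lrmorphism Cleven R m.+1 -> Cl R m}) :
  (forall j, f (cle2 i0 (lift i0 j)) = cle j) -> f =1 beta.
Proof.
move=> f_cle a; rewrite -[in LHS](betaK a) beta_invE linear_sum.
rewrite [RHS](cl_sum_basis (beta a)); apply: eq_bigr => B _.
rewrite linearZ /= clbasis_prod rmorph_prod; congr (_ *: _).
by apply: eq_bigr => j _; exact: f_cle.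
Qed.

End Beta.

Section Alpha.
Context {R : realType} {m : nat} (i0 : 'I_m.+1).
Implicit Types x y : 'rV[R]_m.+1.

(* A vector [y] of [R^(m.+1)] as the paravector [y^0 + \sum_j y^j e_j]; the
   generator written e_j, 1 <= j <= m, is [cle j'] with [j' : 'I_m], [j = j'.+1],
   so that [y^j] is the coordinate [lift ord0 j'] of [y]. *)
Definition paravec y : Cl R m :=
  (y ord0 ord0)%:A + \sum_j y ord0 (lift ord0 j) *: cle j.

(* [alpha] in coordinates: [y^0 = x^(i0)], and [y^1, ..., y^m] are the remaining
   coordinates of [x] in increasing order; see [paravec_alpha].  Here
   [lift i0 j] is [j] for [j < i0] and [j.+1] otherwise. *)
Definition alpha x : 'rV[R]_m.+1 :=
  \row_k x ord0 (oapp (lift i0) i0 (unlift ord0 k)).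

Definition alpha_inv y : 'rV[R]_m.+1 :=
  \row_k y ord0 (oapp (lift ord0) ord0 (unlift i0 k)).

Lemma alphaK : cancel alpha alpha_inv.
Proof.
move=> x; apply/rowP => k; rewrite !mxE.
by case: (unliftP i0 k) => [j ->|->] /=; rewrite ?liftK ?unlift_none.
Qed.

Lemma alpha_invK : cancel alpha_inv alpha.
Proof.
move=> x; apply/rowP => k; rewrite !mxE.
by case: (unliftP ord0 k) => [j ->|->] /=; rewrite ?liftK ?unlift_none.
Qed.

Lemma paravec_alpha x : paravec (alpha x) =
  (x ord0 i0)%:A + \sum_j x ord0 (lift i0 j) *: cle j.
Proof.
rewrite /paravec mxE unlift_none; congr (_ + _).
by apply: eq_bigr => j _; rewrite mxE liftK.
Qed.

End Alpha.

Section Operators.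
Context {R : realType}.

(* Functions on an open set [U] are represented by total functions, of which the
   predicates below only involve the germs at the points of [U]. *)

Definition partial {n : nat} {V : normedModType R} (j : 'I_n)
    (f : 'rV[R]_n -> V) (x : 'rV[R]_n) : V :=
  'D_(delta_mx ord0 j) f x.

Definition C1_on {n : nat} {V : normedModType R} (U : set 'rV[R]_n)
    (f : 'rV[R]_n -> V) : Prop :=
  forall (j : 'I_n) (x : 'rV[R]_n), U x ->
    derivable f x (delta_mx ord0 j) /\ {for x, continuous (partial j f)}.

Definition dirac {n : nat} (f : 'rV[R]_n -> Cl R n) (x : 'rV[R]_n) : Cl R n :=
  \sum_(j < n) cle j * partial j f x.

Definition cauchy_riemann {m : nat} (f : 'rV[R]_m.+1 -> Cl R m)
    (y : 'rV[R]_m.+1) : Cl R m :=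
  partial ord0 f y + \sum_(j < m) cle j * partial (lift ord0 j) f y.

Definition cauchy_riemann_conj {m : nat} (f : 'rV[R]_m.+1 -> Cl R m)
    (y : 'rV[R]_m.+1) : Cl R m :=
  partial ord0 f y - \sum_(j < m) cle j * partial (lift ord0 j) f y.

Definition monogenic_vec {n : nat} (U : set 'rV[R]_n) (f : 'rV[R]_n -> Cl R n) :=
  forall x, U x -> dirac f x = 0.

Definition monogenic_paravec {m : nat} (U : set 'rV[R]_m.+1)
    (f : 'rV[R]_m.+1 -> Cl R m) :=
  forall y, U y -> cauchy_riemann f y = 0.

Definition antimonogenic_paravec {m : nat} (U : set 'rV[R]_m.+1)
    (f : 'rV[R]_m.+1 -> Cl R m) :=
  forall y, U y -> cauchy_riemann_conj f y = 0.

End Operators.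

(* Main.v *)
(* The maps [a |-> beta (even_part a)] and [a |-> beta (odd_part a)] are linear
   on a finite-dimensional space, so they commute with partial derivatives, and
   [alpha_inv] sends the first basis vector to the [i0]-th one and the others to
   the remaining ones.  Hence both operators can be compared at a point.  With
   the even elements g_k = e_(i0) e_k, k <> i0, one has
     e_(i0) (D Phi) = - d_(i0) Phi + \sum_(k <> i0) g_k d_k Phi,
   and g_k e_(i0) = - e_(i0) g_k: the even part of the right-hand side is
   - d_(i0) Phi0 + \sum g_k d_k Phi0, and its odd part is
   - (d_(i0) Phi1 + \sum g_k d_k Phi1).  Finally [beta] sends the g_k to the
   generators of [Cl R m]. *)
Require Import Defs.
From HB Require Import structures.
From mathcomp Require Import all_boot all_order all_algebra.
From mathcomp Require Import all_classical all_reals all_analysis.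

Import Order.TTheory GRing.Theory Num.Theory.
Import numFieldNormedType.Exports.

Local Open Scope classical_set_scope.
Local Open Scope ring_scope.

(** Expansion in [clbasis] writes [L] as a finite sum of coordinate functionals, each continuous,
    times fixed vectors of [V]. *)
Lemma cl_linear_continuous (R : realType) (n : nat) (V : normedModType R)
    (L : {linear Cl R n -> V}) : continuous L.
Proof.
have -> : (L : Cl R n -> V) =
    fun a => \sum_(A : {set 'I_n}) clcoef a A *: L (clbasis A).
  apply/funext => a; rewrite {1}(cl_sum_basis a) linear_sum.
  by apply: eq_bigr => A _; rewrite linearZ.
apply: continuous_big => [|A _]; first exact: add_continuous.
move=> a; apply: (cvgZr_tmp (F := nbhs a)).
exact: (@coord_continuous R _ _ ord0 (enum_rank A)).
Qed.

(** [L] commutes with each difference quotient, and by continuity with the limit that derivability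
    provides. *)
Lemma derive_comp_linear (R : realType) (U V W : normedModType R)
    (L : {linear V -> W}) (f : U -> V) (x v : U) :
  continuous L -> derivable f x v -> 'D_v (L \o f) x = L ('D_v f x).
Proof.
move=> cL df; apply: cvg_lim => //.
have -> : (fun h : R => h^-1 *: ((L \o f \o shift x) (h *: v) - (L \o f) x)) =
    L \o (fun h : R => h^-1 *: ((f \o shift x) (h *: v) - f x)).
  by apply/funext => h; rewrite /= -(linearB L) linearZ.
exact: (cvg_comp _ _ df (cL _)).
Qed.

(** By linearity of [T], both difference quotients are the same function of [h]. *)
Lemma derive_precomp_linear (R : realType) (U V W : normedModType R)
    (T : {linear U -> V}) (f : V -> W) (x v : U) :
  'D_v (f \o T) x = 'D_(T v) f (T x).
Proof.
suff E : (fun h : R => h^-1 *: ((f \o T \o shift x) (h *: v) - (f \o T) x)) =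
    (fun h : R => h^-1 *: ((f \o shift (T x)) (h *: T v) - f (T x))).
  by rewrite /derive E.
by apply/funext => h; rewrite /= (linearD T) linearZ.
Qed.

Section Parts.
Context {R : realType} {n : nat}.

Lemma even_part_is_linear : linear (@even_part R n).
Proof.
move=> k a b; apply: val_inj; apply: clP => A.
rewrite clcoef_even_part clcoefD clcoefZ [RHS]clcoefD [in RHS]clcoefZ.
by rewrite !clcoef_even_part; case: ifP => _; rewrite ?mulr0 ?addr0.
Qed.

HB.instance Definition _ := GRing.isLinear.Build R (Cl R n) (Cleven R n) *:%R
  (@even_part R n) even_part_is_linear.

Lemma odd_part_is_linear (i0 : 'I_n) : linear (@odd_part R n i0).
Proof.
move=> k a b; apply: val_inj.
change (- cle i0 * (k *: a + b - cleven_val (even_part (k *: a + b))) =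
  k *: (- cle i0 * (a - cleven_val (even_part a))) +
  - cle i0 * (b - cleven_val (even_part b))).
rewrite linearP scalerAr -mulrDr scalerBr addrACA -opprD.
by congr (_ * _).
Qed.

HB.instance Definition _ (i0 : 'I_n) :=
  GRing.isLinear.Build R (Cl R n) (Cleven R n) *:%R
    (@odd_part R n i0) (odd_part_is_linear i0).

End Parts.

Section Algebra.
Context {R : realType} {m : nat} (i0 : 'I_m.+1).

(** The generator has inverse [- cle i0], so multiplying the Dirac equation by it loses nothing. *)
Lemma cle_mul_eq0 (a : Cl R m.+1) : cle i0 * a = 0 <-> a = 0.
Proof.
split=> [a0|->]; last exact: mulr0.
by apply: oppr_inj; rewrite -mulN1r -(cle_sq i0) -mulrA a0 mulr0 oppr0.
Qed.

(** Uniqueness of the decomposition, applied to the element 0, whose parts vanish by linearity. *)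
Lemma even_odd_eq0 (u v : Cleven R m.+1) :
  cleven_val u + cle i0 * cleven_val v = 0 <-> u = 0 /\ v = 0.
Proof.
split=> [uv|[-> ->]]; last by rewrite /= mulr0 addr0.
have [-> ->] := even_odd_unique (esym uv).
by rewrite !linear0.
Qed.

(** The algebra behind the formula for e_(i0) (D Phi): [p k] stands for the value of d_k Phi at a
    point. *)
Lemma cle_mul_sum (p : 'I_m.+1 -> Cl R m.+1) :
  let u k := even_part (p k) in let v k := odd_part i0 (p k) in
  cle i0 * (\sum_k cle k * p k) =
  cleven_val (- u i0 + \sum_j cle2 i0 (lift i0 j) * u (lift i0 j)) +
  cle i0 * cleven_val (- (v i0 + \sum_j cle2 i0 (lift i0 j) * v (lift i0 j))).
Proof.
move=> u v.
have pE k : p k = cleven_val (u k) + cle i0 * cleven_val (v k).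
  exact: even_odd_decomposition.
clearbody u v.
have valD (a b : Cleven R m.+1) :
  cleven_val (a + b) = cleven_val a + cleven_val b by [].
have valN (a : Cleven R m.+1) : cleven_val (- a) = - cleven_val a by [].
(* The index [i0] is split off; there e_(i0) squares to -1, which leaves [- p i0]. *)
rewrite !(valD, valN) !cleven_val_sum (bigD1_ord i0) //= mulrDr mulrA cle_sq.
rewrite mulN1r {1}(pE i0) opprD mulrN mulrDr [in RHS]opprD.
have -> : cle i0 * (\sum_(j < m) cle (lift i0 j) * p (lift i0 j)) =
  \sum_j cle i0 * cle (lift i0 j) * cleven_val (u (lift i0 j)) -
  cle i0 * (\sum_j cle i0 * cle (lift i0 j) * cleven_val (v (lift i0 j))).
  rewrite !mulr_sumr -sumrB; apply: eq_bigr => j _.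
  rewrite (pE (lift i0 j)) !mulrDr !mulrA; congr (_ + _).
  (* Swapping [cle (lift i0 j)] with the [cle i0] on its right produces the minus sign of the odd
     sum. *)
  rewrite -(mulrA (cle i0) (cle (lift i0 j)) (cle i0)).
  rewrite (@cle_anti _ _ (lift i0 j)) ?(eq_sym _ i0) ?neq_lift //.
  by rewrite mulrN mulNr !mulrA.
by rewrite addrACA.
Qed.

End Algebra.

Section Alpha.
Context {R : realType} {m : nat} (i0 : 'I_m.+1).

Lemma alpha_inv_is_linear : linear (@alpha_inv R m i0).
Proof. by move=> k x y; apply/rowP => j; rewrite !mxE. Qed.

HB.instance Definition _ := GRing.isLinear.Build R 'rV[R]_m.+1 'rV[R]_m.+1
  *:%R (@alpha_inv R m i0) alpha_inv_is_linear.

Lemma alpha_inv_delta0 :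
  alpha_inv i0 (delta_mx ord0 ord0 : 'rV[R]_m.+1) = delta_mx ord0 i0.
Proof.
apply/rowP => k; rewrite !mxE eqxx /=.
case: unliftP => [j ->|->] /=; last by rewrite !eqxx.
by rewrite !(eq_sym (lift _ _)) !(negPf (neq_lift _ _)).
Qed.

Lemma alpha_inv_delta_lift j :
  alpha_inv i0 (delta_mx ord0 (lift ord0 j) : 'rV[R]_m.+1) =
  delta_mx ord0 (lift i0 j).
Proof.
apply/rowP => k; rewrite !mxE eqxx /=.
case: unliftP => [l ->|->] /=; first by rewrite !(inj_eq lift_inj).
by rewrite !(negPf (neq_lift _ _)).
Qed.

(** A chain rule with linear maps on both sides: [alpha_inv i0] permutes the coordinate directions
    and brings the base point back to [x]. *)
Lemma partial_linear_alpha_inv (L : {linear Cl R m.+1 -> Cl R m})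
    (f : 'rV[R]_m.+1 -> Cl R m.+1) (x : 'rV[R]_m.+1) :
    (forall k, derivable f x (delta_mx ord0 k)) ->
  partial ord0 (L \o f \o alpha_inv i0) (alpha i0 x) = L (partial i0 f x) /\
  forall j, partial (lift ord0 j) (L \o f \o alpha_inv i0) (alpha i0 x) =
            L (partial (lift i0 j) f x).
Proof.
move=> df; split=> [|j]; rewrite /partial derive_precomp_linear /= alphaK.
  rewrite alpha_inv_delta0.
  by rewrite derive_comp_linear //; exact: cl_linear_continuous.
rewrite alpha_inv_delta_lift.
by rewrite derive_comp_linear //; exact: cl_linear_continuous.
Qed.

End Alpha.

Lemma dirac_eq0 (R : realType) (m : nat) (i0 : 'I_m.+1)
    (f : 'rV[R]_m.+1 -> Cl R m.+1) (x : 'rV[R]_m.+1) :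
    (forall k, derivable f x (delta_mx ord0 k)) ->
  Defs.dirac f x = 0 <->
  cauchy_riemann_conj
    (beta i0 \o (fun x => even_part (f x)) \o alpha_inv i0) (alpha i0 x) = 0 /\
  cauchy_riemann
    (beta i0 \o (fun x => odd_part i0 (f x)) \o alpha_inv i0) (alpha i0 x) = 0.
Proof.
move=> df.
(* Each part is composed with [beta i0] first, so that only maps between the normed spaces [Cl] are
   differentiated. *)
pose L0 : {linear Cl R m.+1 -> Cl R m} := beta i0 \o @even_part R m.+1.
pose L1 : {linear Cl R m.+1 -> Cl R m} := beta i0 \o @odd_part R m.+1 i0.
have [P0 P] := partial_linear_alpha_inv i0 L0 f x df.
have [Q0 Q] := partial_linear_alpha_inv i0 L1 f x df.
pose u k := even_part (partial k f x); pose v k := odd_part i0 (partial k f x).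
(* The even component has d_(i0) with a minus sign and the sum with a plus sign: its negative is the
   conjugate operator. *)
have -> : cauchy_riemann_conj
    (beta i0 \o (fun x => even_part (f x)) \o alpha_inv i0) (alpha i0 x) =
    - beta i0 (- u i0 + \sum_j cle2 i0 (lift i0 j) * u (lift i0 j)).
  rewrite (linearD (beta i0)) (linearN (beta i0)) (linear_sum (beta i0)).
  rewrite opprD opprK; congr (_ - _); first exact: P0.
  by apply: eq_bigr => j _; rewrite rmorphM /= beta_cle2; congr (_ * _); exact: P.
have -> : cauchy_riemann
    (beta i0 \o (fun x => odd_part i0 (f x)) \o alpha_inv i0) (alpha i0 x) =
    - beta i0 (- (v i0 + \sum_j cle2 i0 (lift i0 j) * v (lift i0 j))).
  rewrite (linearN (beta i0)) opprK (linearD (beta i0)) (linear_sum (beta i0)).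
  congr (_ + _); first exact: Q0.
  by apply: eq_bigr => j _; rewrite rmorphM /= beta_cle2; congr (_ * _); exact: Q.
have beta0 (a : Cleven R m.+1) : - beta i0 a = 0 <-> a = 0.
  split=> [/eqP|->]; last by rewrite linear0 oppr0.
  by rewrite oppr_eq0 => /eqP a0; apply: (@beta_inj _ _ i0); rewrite a0 linear0.
apply: (iff_trans (iff_sym (cle_mul_eq0 i0 _))).
rewrite [cle i0 * _](cle_mul_sum i0 (fun k => partial k f x)).
by rewrite even_odd_eq0 !beta0.
Qed.

(* The ambient dimension is n = m.+1, so that n - 1 = m. *)
Theorem theorem3 (R : realType) (m : nat) (hn : (2 <= m.+1)%N) (i0 : 'I_m.+1)
    (Omega : set 'rV[R]_m.+1) (hOmega : open Omega)
    (Phi : 'rV[R]_m.+1 -> Cl R m.+1) (hPhi : C1_on Omega Phi) :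
  let Phi0 : 'rV[R]_m.+1 -> Cleven R m.+1 := fun x => even_part (Phi x) in
  let Phi1 : 'rV[R]_m.+1 -> Cleven R m.+1 := fun x => odd_part i0 (Phi x) in
  let Phi0_hat : 'rV[R]_m.+1 -> Cl R m := beta i0 \o Phi0 \o alpha_inv i0 in
  let Phi1_hat : 'rV[R]_m.+1 -> Cl R m := beta i0 \o Phi1 \o alpha_inv i0 in
  (monogenic_vec Omega Phi <->
     antimonogenic_paravec (alpha i0 @` Omega) Phi0_hat /\
     monogenic_paravec (alpha i0 @` Omega) Phi1_hat) /\
  (forall x y : 'rV[R]_m.+1, Omega x -> x = alpha_inv i0 y ->
     Phi x = cleven_val (beta_inv i0 (Phi0_hat y)) +
             cle i0 * cleven_val (beta_inv i0 (Phi1_hat y))).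
Proof.
move=> Phi0 Phi1 Phi0_hat Phi1_hat; split; last first.
  move=> x y _ ->; rewrite /Phi0_hat /Phi1_hat /= !betaK.
  exact: even_odd_decomposition.
(* The image of [Omega] consists of the points [alpha i0 x], so a pointwise equivalence suffices. *)
have D x : Omega x -> Defs.dirac Phi x = 0 <->
    cauchy_riemann_conj Phi0_hat (alpha i0 x) = 0 /\
    cauchy_riemann Phi1_hat (alpha i0 x) = 0.
  by move=> Ox; apply: dirac_eq0 => k; have [] := hPhi k x Ox.
split=> [H|[H0 H1] x Ox].
  by split=> _ [x Ox <-]; have [] := (D x Ox).1 (H x Ox).
by apply/(D x Ox); split; [apply: H0|apply: H1]; exists x.
Qed.
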